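(* If $x^*$ is a supported efficient solution of the multiobjective integer program $\max\{Cx\mid Ax\leqq b,\ x\in\mathbb{Z}^n_{\geqq}\}$, then there is a function $F$ feasible to the set-valued superadditive dual (SDP) such that $Cx^*\in F(b)$.
   Context: Vector orders on $\mathbb{R}^k$ (and $\mathbb{R}^m$): $x\leqq y$ if $y-x$ has all nonnegative components; $x\le y$ if $x\leqq y$ and $x\ne y$. $\mathbb{R}^k_{>}$: all components positive. $A\in\mathbb{R}^{m\times n}$ with columns $A_j$, $b\in\mathbb{R}^m$, $C\in\mathbb{R}^{k\times n}$ with columns $C_j$. A feasible $x^*$ is efficient if no feasible $x$ satisfies $Cx^*\le Cx$; an efficient $x^*$ is supported if there is $\mu\in\mathbb{R}^k_{>}$ such that $x^*$ is optimal for $\max\{\mu^\top Cx\mid Ax\leqq b,\ x\in\mathbb{Z}^n_{\geqq}\}$. Set order $\preceq$: for nonempty $S,T\subseteq\mathbb{R}^k$, $S\preceq T$ if (i) for every $s\in S$ there is $t\in T$ with $s\leqq t$, and (ii) for all $s\in S,t\in T$, not $t\le s$. With two formal symbols $\pm M_\infty$: $-M_\infty\preceq S\preceq M_\infty$ for all nonempty $S\subseteq\mathbb{R}^k$, $-M_\infty\preceq-M_\infty$, $-M_\infty\preceq M_\infty$, $M_\infty\preceq M_\infty$, and $S\not\preceq-M_\infty$, $M_\infty\not\preceq S$, $M_\infty\not\preceq-M_\infty$. Let $\mathcal{E}=\{S\subseteq\mathbb{R}^k\mid S\neq\emptyset,\ \text{and } s\not\le t,\ t\not\le s \text{ for all }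 s,t\in S\}\cup\{-M_\infty,M_\infty\}$. $F:\mathbb{R}^m\to\mathcal{E}$ is nondecreasing if $\beta_1\leqq\beta_2$ implies $F(\beta_1)\preceq F(\beta_2)$, and superadditive if $F(\beta_1)+F(\beta_2)\preceq F(\beta_1+\beta_2)$ for all $\beta_1,\beta_2$, where $+$ is the Minkowski sum (extended to the symbols by $S+(-M_\infty)=-M_\infty$ for all $S\in\mathcal{E}$ and $S+M_\infty=M_\infty$ for $S\neq-M_\infty$). (SDP): minimize $F(b)$ over functions $F:\mathbb{R}^m\to\mathcal{E}$ that are superadditive and nondecreasing and satisfy $\{C_j\}\preceq F(A_j)$ for $j=1,\dots,n$ and $0\in F(0)$. Such $F$ are called feasible to (SDP). *)

(* Defs.v *)
(* Vectors of R^n are column matrices 'cV[R]_n over a realType,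
   subsets of R^k are the sets of mathcomp-classical. *)
From HB Require Import structures.
From mathcomp Require Import all_boot all_order all_algebra.
From mathcomp Require Import classical_sets reals.
Set Implicit Arguments.
Unset Strict Implicit.
Unset Printing Implicit Defensive.
Import Order.TTheory GRing.Theory Num.Theory.
Local Open Scope classical_set_scope.
Local Open Scope ring_scope.

Section VectorOrders.
Context {R : realType} {k : nat}.
Implicit Types x y : 'cV[R]_k.

Definition vleqq x y : Prop := forall i, x i 0 <= y i 0.

(* Not the componentwise strict order: only x != y is required on top of
   vleqq. *)
Definition vle x y : Prop := vleqq x y /\ x <> y.

Definition vpos x : Prop := forall i, 0 < x i 0.

End VectorOrders.

Section IntegerProgram.
Context {R : realType} {k m n : nat}.
Implicit Types (A : 'M[R]_(m, n)) (b : 'cV[R]_m) (C : 'M[R]_(k, n)).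
Implicit Types (x : 'cV[int]_n).

Definition realv x : 'cV[R]_n := map_mx intr x.

Definition ip_feasible A b x : Prop :=
  (forall i, 0 <= x i 0) /\ vleqq (A *m realv x) b.

Definition efficient A b C x : Prop :=
  ip_feasible A b x /\
  ~ exists y, ip_feasible A b y /\ vle (C *m realv x) (C *m realv y).

Definition scalarized (mu : 'cV[R]_k) C x : R := (mu^T *m C *m realv x) 0 0.

Definition scalarized_optimal (mu : 'cV[R]_k) A b C x : Prop :=
  ip_feasible A b x /\
  forall y, ip_feasible A b y -> scalarized mu C y <= scalarized mu C x.

Definition supported_efficient A b C x : Prop :=
  efficient A b C x /\ exists mu, vpos mu /\ scalarized_optimal mu A b C x.

End IntegerProgram.

(* The subsets of R^k together with the formal symbols -M_oo and M_oo. *)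
Inductive extset (R : realType) (k : nat) : Type :=
  | NegM
  | PosM
  | SetM of set 'cV[R]_k.
Arguments NegM {R k}.
Arguments PosM {R k}.
Arguments SetM {R k} _.

Section SetOrder.
Context {R : realType} {k : nat}.
Implicit Types (S T : set 'cV[R]_k) (X Y : extset R k).

Definition set_preceq S T : Prop :=
  (forall s, S s -> exists2 t, T t & vleqq s t) /\
  (forall s t, S s -> T t -> ~ vle t s).

(* Only meaningful when the sets involved are nonempty, which is always the
   case for elements of Eset below and for their Minkowski sums. *)
Definition preceq X Y : Prop :=
  match X, Y with
  | NegM, _ => True
  | _, PosM => True
  | SetM U, SetM V => set_preceq U V
  | SetM _, NegM => False
  | PosM, SetM _ => False
  | PosM, NegM => False
  end.

Definition Eset : set (extset R k) := fun X =>
  match X with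
  | SetM U => U !=set0 /\ (forall s t, U s -> U t -> ~ vle s t /\ ~ vle t s)
  | _ => True
  end.

(* -M_oo is absorbing, including in -M_oo + M_oo. *)
Definition addM X Y : extset R k :=
  match X, Y with
  | NegM, _ | _, NegM => NegM
  | PosM, _ | _, PosM => PosM
  | SetM U, SetM V => SetM [set s + t | s in U & t in V]
  end.

(* The symbols -M_oo and M_oo have no elements. *)
Definition inM (y : 'cV[R]_k) X : Prop :=
  if X is SetM U then U y else False.

End SetOrder.

Section SuperadditiveDual.
Context {R : realType} {k m n : nat}.
Implicit Types (F : 'cV[R]_m -> extset R k).

Definition nondecreasingM F : Prop :=
  forall beta1 beta2, vleqq beta1 beta2 -> preceq (F beta1) (F beta2).

Definition superadditiveM F : Prop :=
  forall beta1 beta2,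
    preceq (addM (F beta1) (F beta2)) (F (beta1 + beta2)).

Definition sdp_feasible (A : 'M[R]_(m, n)) (C : 'M[R]_(k, n)) F : Prop :=
  [/\ forall beta, Eset (F beta),
      superadditiveM F,
      nondecreasingM F,
      forall j, preceq (SetM [set col j C]) (F (col j A)) &
      inM 0 (F 0)].

End SuperadditiveDual.

(* Main.v *)
Require Import Defs.
From HB Require Import structures.
From mathcomp Require Import all_boot all_order all_algebra.
From mathcomp Require Import boolp classical_sets reals.
Set Implicit Arguments.
Unset Strict Implicit.
Unset Printing Implicit Defensive.
Import Order.TTheory GRing.Theory Num.Theory.
Local Open Scope ring_scope.

(** Let [mu > 0] be a weight for which [x] maximizes [mu^T C y] over the
    program.  The classical superadditive dual of this scalar program is solved
    by its value function [phi beta = sup {mu^T C y | A y <= beta, y >= 0}],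
    with [y] integral, and the proof lifts [phi] to sets: [F beta] is the
    hyperplane [{z | mu^T z = phi beta}], with [NegM] and [PosM] in place of the
    values [-oo] (no feasible point) and [+oo].

    Positivity of [mu] makes this lifting faithful.  The form [mu^T z] is
    strictly monotone for the componentwise order, so no two points of a
    hyperplane are comparable and no point of a higher hyperplane lies below a
    point of a lower one; and any point can be raised along a coordinate axis to
    reach a prescribed higher hyperplane.  Hence a set on which [mu^T z <= c]
    precedes the hyperplane at level [c] ([set_preceq_level]), and each
    condition on [F] becomes an inequality between values of [phi]: feasible
    points add up, which gives superadditivity ([preceq_addM_lift]), and
    enlarging [beta] enlarges the feasible set, which gives monotonicity
    ([preceq_lift]).

    What remains is [phi 0 = 0] and [phi b = mu^T C x].  The second is the
    optimality of [x].  For the first, an integral solution [y >= 0]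
    of [A y <= 0] with [mu^T C y > 0] would make [x + y] a better
    feasible point than [x].

    For [k = 0] a hyperplane may be empty and raising a point is impossible, but
    then [R^0] is a single point and the constant function [{0}] works. *)

Section Hyperplanes.
Local Open Scope classical_set_scope.
Context {R : realType}.

Definition weight {k} (mu s : 'cV[R]_k) : R := (mu^T *m s) 0 0.

Definition level {k} (mu : 'cV[R]_k) (c : R) : set 'cV[R]_k :=
  [set s | weight mu s = c].

Lemma weightD k (mu s t : 'cV[R]_k) :
  weight mu (s + t) = weight mu s + weight mu t.
Proof. by rewrite /weight mulmxDr mxE. Qed.

Lemma weight0 k (mu : 'cV[R]_k) : weight mu 0 = 0.
Proof. by rewrite /weight mulmx0 mxE. Qed.

Lemma weight_axis k (mu : 'cV[R]_k) a i :
  weight mu (a *: delta_mx i 0) = a * mu i 0.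
Proof. by rewrite /weight -scalemxAr -colE !mxE. Qed.

Lemma weight_lt k (mu s t : 'cV[R]_k) :
  vpos mu -> vle s t -> weight mu s < weight mu t.
Proof.
move=> mu_gt0 [le_st neq_st]; rewrite /weight !mxE.
have [i neq_i] : exists i, s i 0 != t i 0.
  apply/not_existsP => eq_st; apply: neq_st; apply/matrixP => i j.
  by rewrite ord1; apply/eqP/negPn/negP/eq_st.
rewrite (bigD1 i) //= [ltRHS](bigD1 i) //=; apply: ltr_leD.
  by rewrite !mxE ltr_pM2l // lt_neqAle neq_i le_st.
by apply: ler_sum => j _; rewrite !mxE ler_pM2l.
Qed.

(** Raising the first coordinate of [s] alone suffices, at the rate
    [mu 0 0 > 0]; this is where a coordinate has to exist. *)
Lemma level_reach k (mu s : 'cV[R]_k.+1) c :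
  vpos mu -> weight mu s <= c -> exists2 t, level mu c t & vleqq s t.
Proof.
move=> mu_gt0 le_sc.
exists (s + ((c - weight mu s) / mu 0 0) *: delta_mx 0 0).
  rewrite /level /= weightD weight_axis divfK ?gt_eqF //.
  by rewrite addrC subrK.
move=> i; rewrite !mxE lerDl mulr_ge0 ?ler0n //.
by rewrite divr_ge0 ?subr_ge0 // ltW.
Qed.

Lemma set_preceq_level k (mu : 'cV[R]_k.+1) (S : set 'cV[R]_k.+1) c :
  vpos mu -> (forall s, S s -> weight mu s <= c) -> set_preceq S (level mu c).
Proof.
move=> mu_gt0 le_Sc; split=> [s Ss|s t Ss tc lt_ts].
  by apply: level_reach => //; apply: le_Sc.
have := weight_lt mu_gt0 lt_ts; rewrite tc => /lt_le_trans /(_ (le_Sc s Ss)).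
by rewrite ltxx.
Qed.

(** The hyperplane at the supremum of [V]; the two symbols stand for the
    suprema [-oo] and [+oo]. *)
Definition lift {k} (mu : 'cV[R]_k) (V : set R) : extset R k :=
  if `[< V = set0 >] then NegM
  else if `[< has_ubound V >] then SetM (level mu (sup V)) else PosM.

Variant lift_spec {k} (mu : 'cV[R]_k) (V : set R) : extset R k -> Prop :=
  | LiftNeg of V = set0 : lift_spec mu V NegM
  | LiftSet of has_sup V : lift_spec mu V (SetM (level mu (sup V)))
  | LiftPos of V !=set0 & ~ has_ubound V : lift_spec mu V PosM.

Lemma liftP k (mu : 'cV[R]_k) V : lift_spec mu V (lift mu V).
Proof.
rewrite /lift; case: asboolP => [V0|/eqP/set0P V0]; first exact: LiftNeg.
by case: asboolP => [ubV|ubV]; [apply: LiftSet | apply: LiftPos].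
Qed.

Lemma lift_max k (mu : 'cV[R]_k) V v :
  V v -> ubound V v -> lift mu V = SetM (level mu v).
Proof.
move=> Vv ubv.
have sup_v : sup V = v.
  apply/eqP; rewrite eq_le ge_sup //=; last by exists v.
  by apply: ub_le_sup => //; exists v.
case: liftP => [V0|_|_ []]; last by exists v.
  by rewrite V0 in Vv.
by rewrite sup_v.
Qed.

Lemma Eset_lift k (mu : 'cV[R]_k.+1) V : vpos mu -> Eset (lift mu V).
Proof.
move=> mu_gt0; case: liftP => //= _; split.
  exists ((sup V / mu 0 0) *: delta_mx 0 0).
  by rewrite /level /= weight_axis divfK ?gt_eqF.
by move=> s t sc tc; split=> /(weight_lt mu_gt0); rewrite sc tc ltxx.
Qed.

Lemma preceq_SetM_lift k (mu : 'cV[R]_k.+1) (S : set 'cV[R]_k.+1) V :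
  vpos mu -> V !=set0 ->
  (has_ubound V -> forall s, S s -> weight mu s <= sup V) ->
  preceq (SetM S) (lift mu V).
Proof.
move=> mu_gt0 /set0P/eqP V0 le_SV.
by case: liftP => //= -[_ ubV]; apply: set_preceq_level => //; apply: le_SV.
Qed.

Lemma preceq_lift k (mu : 'cV[R]_k.+1) V W :
  vpos mu -> V `<=` W -> preceq (lift mu V) (lift mu W).
Proof.
move=> mu_gt0 VW; case: (liftP mu V) => // [[V0 ubV]|V0 nubV].
  apply: preceq_SetM_lift => //; first exact: subset_nonempty V0.
  move=> ubW s ->; apply: ge_sup => // v /VW.
  exact: ub_le_sup.
case: liftP => //= [W0|[_ [M ubM]]].
  by case: V0 => v /VW; rewrite W0.
by apply: nubV; exists M => v /VW; apply: ubM.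
Qed.

(** If [W] is bounded above, so is each summand, since the other one has an
    element; hence [PosM] on the left forces [PosM] on the right. *)
Lemma preceq_addM_lift k (mu : 'cV[R]_k.+1) V1 V2 W :
  vpos mu -> (forall v1 v2, V1 v1 -> V2 v2 -> W (v1 + v2)) ->
  preceq (addM (lift mu V1) (lift mu V2)) (lift mu W).
Proof.
move=> mu_gt0 VW.
have [V10|/set0P V10] := eqVneq V1 set0.
  by rewrite /lift V10 asboolT.
have [V20|/set0P V20] := eqVneq V2 set0.
  rewrite /lift V20 [`[< set0 = set0 >]]asboolT //.
  by case: ifP => //; case: ifP.
have [[v1 V1v1] [v2 V2v2]] := (V10, V20).
have W0 : W !=set0 by exists (v1 + v2); apply: VW.
have [ubW|nubW] := pselect (has_ubound W); last first.
  case: (liftP mu W) => [W00|[_ //]|_ _]; last by case: addM.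
  by rewrite W00 in W0; case: W0.
have ubV1 : has_ubound V1.
  case: ubW => M ubM; exists (M - v2) => v V1v.
  by rewrite lerBrDr; apply/ubM/VW.
have ubV2 : has_ubound V2.
  case: ubW => M ubM; exists (M - v1) => v V2v.
  by rewrite lerBrDl; apply/ubM/VW.
case: (liftP mu V1) => // _; case: (liftP mu V2) => // _.
apply: preceq_SetM_lift => // _ _ [s1 s1c [s2 s2c <-]].
rewrite weightD s1c s2c -lerBrDr; apply: ge_sup => // u1 V1u1.
rewrite lerBrDr -lerBrDl; apply: ge_sup => // u2 V2u2.
by rewrite lerBrDl; apply: ub_le_sup => //; apply: VW.
Qed.

End Hyperplanes.

Section ValueFunction.
Local Open Scope classical_set_scope.
Context {R : realType} {k m n : nat}.
Implicit Types (A : 'M[R]_(m, n)) (C : 'M[R]_(k, n)) (y z : 'cV[int]_n).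

Definition values (mu : 'cV[R]_k) A C (beta : 'cV[R]_m) : set R :=
  [set scalarized mu C y | y in [set y | ip_feasible A beta y]].

Lemma scalarizedE (mu : 'cV[R]_k) C y :
  scalarized mu C y = weight mu (C *m realv y).
Proof. by rewrite /scalarized /weight mulmxA. Qed.

Lemma realvD y z : realv (y + z) = realv y + realv z :> 'cV[R]_n.
Proof. exact: map_mxD. Qed.

Lemma realv0 : realv (0 : 'cV[int]_n) = 0 :> 'cV[R]_n.
Proof. exact: map_mx0. Qed.

Lemma realv_delta j :
  realv (delta_mx j 0 : 'cV[int]_n) = delta_mx j 0 :> 'cV[R]_n.
Proof. exact: map_delta_mx. Qed.

Lemma ip_feasibleD A beta1 beta2 y z :
  ip_feasible A beta1 y -> ip_feasible A beta2 z ->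
  ip_feasible A (beta1 + beta2) (y + z).
Proof.
move=> [y0 yb] [z0 zb]; split=> i; first by rewrite mxE addr_ge0.
by rewrite realvD mulmxDr mxE [leRHS]mxE lerD.
Qed.

Lemma ip_feasible0 A : ip_feasible A 0 0.
Proof. by split=> i; rewrite ?realv0 ?mulmx0 !mxE. Qed.

Lemma ip_feasible_col A j : ip_feasible A (col j A) (delta_mx j 0).
Proof. by split=> i; rewrite ?realv_delta -?colE // !mxE ler0n. Qed.

Lemma scalarizedD (mu : 'cV[R]_k) C y z :
  scalarized mu C (y + z) = scalarized mu C y + scalarized mu C z.
Proof. by rewrite !scalarizedE realvD mulmxDr weightD. Qed.

Lemma values_add (mu : 'cV[R]_k) A C beta1 beta2 v1 v2 :
  values mu A C beta1 v1 -> values mu A C beta2 v2 ->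
  values mu A C (beta1 + beta2) (v1 + v2).
Proof.
move=> [y yf <-] [z zf <-]; exists (y + z); last exact: scalarizedD.
exact: ip_feasibleD.
Qed.

Lemma values_mono (mu : 'cV[R]_k) A C beta1 beta2 :
  vleqq beta1 beta2 -> values mu A C beta1 `<=` values mu A C beta2.
Proof.
move=> le_beta _ [y [y0 yb] <-]; exists y => //; split=> // i.
exact: le_trans (yb i) (le_beta i).
Qed.

Lemma values0 (mu : 'cV[R]_k) A C : values mu A C 0 0.
Proof.
exists 0; first exact: ip_feasible0.
by rewrite scalarizedE realv0 mulmx0 weight0.
Qed.

(** A positive value at right-hand side [0] could be added to an optimal
    solution and improve it. *)
Lemma values0_le0 (mu : 'cV[R]_k) A b C x :
  scalarized_optimal mu A b C x -> ubound (values mu A C 0) 0.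
Proof.
move=> [xf xopt] _ [y yf <-].
rewrite -(lerD2l (scalarized mu C x)) addr0 -scalarizedD; apply: xopt.
by rewrite -[b]addr0; apply: ip_feasibleD.
Qed.

End ValueFunction.

Lemma sdp_feasible_lift (R : realType) (k m n : nat) (mu : 'cV[R]_k.+1)
    (A : 'M[R]_(m, n)) (b : 'cV[R]_m) (C : 'M[R]_(k.+1, n)) (x : 'cV[int]_n) :
  vpos mu -> scalarized_optimal mu A b C x ->
  sdp_feasible A C (fun beta => lift mu (values mu A C beta)).
Proof.
move=> mu_gt0 xopt; split=> [beta|beta1 beta2|beta1 beta2 le_beta|j|].
- exact: Eset_lift.
- by apply: preceq_addM_lift => // v1 v2; apply: values_add.
- by apply: preceq_lift => //; apply: values_mono.
- have Vj : values mu A C (col j A) (weight mu (col j C)).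
    exists (delta_mx j 0); first exact: ip_feasible_col.
    by rewrite scalarizedE realv_delta -colE.
  apply: preceq_SetM_lift => //; first by exists (weight mu (col j C)).
  by move=> ubV _ ->; apply: ub_le_sup.
- rewrite (lift_max mu (values0 mu A C) (values0_le0 xopt)).
  exact: weight0.
Qed.

Lemma sdp_feasible_setT (R : realType) (m n : nat)
    (A : 'M[R]_(m, n)) (C : 'M[R]_(0, n)) :
  sdp_feasible A C (fun=> SetM setT).
Proof.
have nle (s t : 'cV[R]_0) : ~ vle s t by case=> _; apply; rewrite !flatmx0.
have le_setT (S : set 'cV[R]_0) : set_preceq S setT.
  by split=> [s _|s t _ _]; [exists s => // i; rewrite lexx | apply: nle].
split=> [_|beta1 beta2|beta1 beta2 _|j|]; try exact: le_setT; last by [].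
by split=> [|s t _ _]; [exists 0 | split; apply: nle].
Qed.

Theorem theorem10 (R : realType) (k m n : nat)
    (A : 'M[R]_(m, n)) (b : 'cV[R]_m) (C : 'M[R]_(k, n)) (x : 'cV[int]_n) :
  supported_efficient A b C x ->
  exists F : 'cV[R]_m -> extset R k,
    sdp_feasible A C F /\ inM (C *m realv x) (F b).
Proof.
move=> [_ [mu [mu_gt0 xopt]]].
case: k C mu mu_gt0 xopt => [|k] C mu mu_gt0 xopt.
  by exists (fun=> SetM setT); split=> //; apply: sdp_feasible_setT.
exists (fun beta => lift mu (values mu A C beta)); split.
  exact: sdp_feasible_lift xopt.
case: xopt => xf xmax; rewrite (@lift_max _ _ mu _ (scalarized mu C x)).
- by rewrite /= /level /= scalarizedE.
- by exists x.
- by move=> _ [y yf <-]; apply: xmax.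
Qed.
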